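(* Let $d=(d_1,\dots,d_n)$ be a graphic list, and let $P(d)\subseteq\mathbb{R}^{\binom{n}{2}}$ be the polytope of all $x=(x_{ij})$ (indexed by unordered pairs of distinct elements of $[n]$) with $\sum_{i\neq j}x_{ij}=d_j$ for all $j\in[n]$ and $0\le x_{ij}\le 1$ for all $i<j$. The following are equivalent: (1) $d$ is decisive, i.e., every vertex of $P(d)$ has all coordinates in $\{0,1\}$; (2) no realization of $d$ contains an integral $(k,\ell)$-blossom for any odd integers $k,\ell\ge 3$; (3) no realization of $d$ contains an integral $(3,3)$-blossom.
   Context: A realization of $d$ is a simple graph on vertex set $[n]$ in which vertex $i$ has degree $d_i$ for every $i$. For odd integers $k,\ell\ge3$, an integral $(k,\ell)$-blossom in a simple graph $G$ consists of $k+\ell$ distinct vertices $v_1,\dots,v_k,w_1,\dots,w_\ell$ such that, in the sequence of vertex pairs $$v_1v_2,\ v_2v_3,\ \dots,\ v_{k-1}v_k,\ v_kv_1,\ v_1w_1,\ w_1w_2,\ w_2w_3,\ \dots,\ w_{\ell-1}w_\ell,\ w_\ell w_1,$$ consecutive pairs alternate between being non-edges and edges of $G$ (the pair $v_1w_1$ may be either an edge or a non-edge). Nothing is required of other pairs among these vertices. *)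

(* Defs.v *)
From mathcomp Require Import all_boot all_order all_algebra.
From mathcomp Require Import classical_sets reals.

Set Implicit Arguments.
Unset Strict Implicit.
Unset Printing Implicit Defensive.

Import Order.TTheory GRing.Theory Num.Theory.
Local Open Scope classical_set_scope.
Local Open Scope ring_scope.

(* The vertex set [n] = {1, ..., n} is rendered as 'I_n. *)
Record sgraph (n : nat) := SGraph {
  adj :> rel 'I_n;
  adj_sym : symmetric adj;
  adj_irrefl : irreflexive adj
}.

Definition degree n (G : sgraph n) (i : 'I_n) : nat := #|[set j : 'I_n | G i j]%SET|.

Definition realization n (d : n.-tuple nat) (G : sgraph n) : Prop :=
  forall i : 'I_n, degree G i = tnth d i.

Definition graphic n (d : n.-tuple nat) : Prop :=
  exists G : sgraph n, realization d G.

(* v_1 :: v and w_1 :: w list the vertices of the two odd cycles.  The pairs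
   form a linear (not cyclic) sequence of length k + l + 1, and two successive
   pairs must have opposite adjacency status; whether the first pair is an edge
   or a non-edge is left free. *)
Definition blossom_pairs (T : Type) (v1 : T) (v : seq T) (w1 : T) (w : seq T)
    : seq (T * T) :=
  zip (v1 :: v) (rcons v v1) ++ (v1, w1) :: zip (w1 :: w) (rcons w w1).

Definition has_blossom n (G : sgraph n) (k l : nat) : Prop :=
  exists (v1 : 'I_n) (v : seq 'I_n) (w1 : 'I_n) (w : seq 'I_n),
    [/\ size (v1 :: v) = k,
        size (w1 :: w) = l,
        uniq ((v1 :: v) ++ (w1 :: w)) &
        sorted (fun p q => G p.1 p.2 != G q.1 q.2) (blossom_pairs v1 v w1 w)].

Definition upair (n : nat) : finType := {e : {set 'I_n} | #|e| == 2%N}.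

(* Unordered pairs index the coordinates; R^o is R viewed as a module over
   itself, which makes this space an lmodType R. *)
Definition pair_space (R : realType) (n : nat) := {ffun upair n -> R^o}.

(* The pairs e containing j are exactly the {i, j} with i != j. *)
Definition degree_polytope (R : realType) n (d : n.-tuple nat)
    : set (pair_space R n) :=
  [set x | (forall j : 'I_n,
              \sum_(e : upair n | j \in val e) x e = (tnth d j)%:R)
           /\ (forall e : upair n, 0 <= x e <= 1)].
Arguments degree_polytope R {n} d.

(* Vertices of a polytope, as its extreme points: the points that are not
   proper convex combinations of two other points of it. *)
Definition is_vertex (R : realType) (V : lmodType R) (P : set V) (x : V) : Prop :=
  P x /\ forall (y z : V) (t : R), P y -> P z -> 0 < t < 1 ->
           x = t *: y + (1 - t) *: z -> y = x /\ z = x.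

Definition decisive (R : realType) n (d : n.-tuple nat) : Prop :=
  forall x : pair_space R n, is_vertex (degree_polytope R d) x ->
    forall e : upair n, x e = 0 \/ x e = 1.

(* Main.v *)
Require Import Defs.
From mathcomp Require Import all_boot all_order all_algebra.
From mathcomp Require Import classical_sets reals.
From mathcomp Require Import zify ring lra.

(* Points of the polytope are handled as symmetric matrices g with zero
   diagonal. A point is a vertex iff it is rigid: no nonzero symmetric matrix
   supported on its fractional entries has zero row sums.
   (3) => (1). Rigidity makes the incidence matrix of the graph of fractional
   pairs have independent rows, so there are at most as many fractional pairs
   as touched vertices; integrality of the row sums gives every touched
   vertex at least two fractional pairs, hence exactly two. Then g - 1/2
   restricted to the fractional pairs has zero row sums, so all fractional
   entries are 1/2. If a, b, c, e is a path of distinct vertices in this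
   2-regular graph, moving along the 4-cycle a b c e makes ab, bc, ce
   integral and ae fractional, preserves rigidity and touches fewer vertices.
   When no such path is left, all components are triangles, and by parity
   there are at least two; the inverse of the perturbation of a blossom makes
   two of them integral. When the last two triangles disappear they leave a
   realization with a (3,3)-blossom.
   (1) => (2). Switching 4-cycles shortens a (k,l)-blossom to a
   (3,3)-blossom, and setting the pairs of its two triangles to 1/2 and
   flipping the pair joining them gives a rigid, non-integral point. *)

Set Implicit Arguments.
Unset Strict Implicit.
Unset Printing Implicit Defensive.

Import Order.TTheory GRing.Theory Num.Theory.
Local Open Scope ring_scope.

(** * Fractional pairs of a rigid point: a 2-regular graph with all values 1/2 *)

Definition edge_fun (R : realType) n (a b i j : 'I_n) : R :=
  ((i == a) && (j == b))%:R + ((i == b) && (j == a))%:R.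

Definition fpoint (R : realType) n (d : n.-tuple nat) (g : 'I_n -> 'I_n -> R) :=
  [/\ forall i j, g i j = g j i, forall i, g i i = 0,
      forall i j, 0 <= g i j <= 1 & forall i, \sum_j g i j = (tnth d i)%:R].

Definition fractional (R : realType) n (g : 'I_n -> 'I_n -> R)
  (i j : 'I_n) : bool := 0 < g i j < 1.

(** The size of [y] is not bounded: this is a purely linear form of extremality, related to vertices
    by [vertex_rigid] and [rigid_vertex]. *)
Definition rigid (R : realType) n (g : 'I_n -> 'I_n -> R) : Prop :=
  forall y : 'I_n -> 'I_n -> R, (forall i j, y i j = y j i) ->
    (forall i j, ~~ fractional g i j -> y i j = 0) ->
    (forall i, \sum_j y i j = 0) -> forall i j, y i j = 0.

Definition touched (R : realType) n (g : 'I_n -> 'I_n -> R) : {set 'I_n} :=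
  [set i | [exists j, fractional g i j]]%SET.

(** Handshake: swapping components matches the pairs with [p.1 < p.2] to those in the opposite
    order. *)
Lemma sum_card_sym n (r : rel 'I_n) : symmetric r -> irreflexive r ->
  (\sum_i #|[set j | r i j]%SET| =
   #|[set p : 'I_n * 'I_n | r p.1 p.2 && (p.1 < p.2)%N]%SET|.*2)%N.
Proof.
move=> rC r0; transitivity #|[set p | r p.1 p.2]%SET|.
  rewrite -sum1_card (eq_bigl (fun p => predT p.1 && r p.1 p.2)); last first.
    by move=> p; rewrite inE.
  rewrite -(pair_big_dep predT r (fun _ _ => 1%N)) /=.
  by apply: eq_bigr => i _; rewrite sum1dep_card.
rewrite -addnn -(cardsID [set p : 'I_n * 'I_n | (p.1 < p.2)%N]%SET).
congr (_ + _)%N; first by apply: eq_card => p; rewrite !inE.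
rewrite -[RHS](card_imset _ (f := fun p : 'I_n * 'I_n => (p.2, p.1)));
  last first.
  by move=> [? ?] [? ?] [-> ->].
apply: eq_card => [[u v]]; rewrite !inE /=; apply/andP/imsetP.
  case=> nlt ruv; exists (v, u) => //; rewrite inE /= rC ruv /=.
  rewrite ltn_neqAle leqNgt nlt andbT.
  by apply: contraTneq ruv => /ord_inj ->; rewrite r0.
case=> [[v' u']]; rewrite inE /= => /andP[rvu lt] [-> ->].
by rewrite -leqNgt ltnW // rC.
Qed.

Section FractionalPoints.
Variables (R : realType) (n : nat).
Implicit Types (d : n.-tuple nat) (g y : 'I_n -> 'I_n -> R) (i j : 'I_n).

Lemma edge_funC (a b i j : 'I_n) : edge_fun R a b i j = edge_fun R a b j i.
Proof. by rewrite /edge_fun addrC ![(j == _) && _]andbC. Qed.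

Lemma sum_edge_fun (a b i : 'I_n) :
  \sum_j edge_fun R a b i j = (i == a)%:R + (i == b)%:R.
Proof.
have pick (u v : 'I_n) : \sum_j ((i == u) && (j == v))%:R = (i == u)%:R :> R.
  rewrite (bigD1 v) //= eqxx andbT big1 ?addr0 // => j /negbTE ->.
  by rewrite andbF.
by rewrite big_split /= !pick.
Qed.

Lemma edge_fun_eq0 (a b i j : 'I_n) :
  (i, j) != (a, b) -> (j, i) != (a, b) -> edge_fun R a b i j = 0.
Proof.
rewrite /edge_fun !xpair_eqE => /negbTE -> /negbTE.
by rewrite andbC => ->; rewrite addr0.
Qed.

Lemma edge_fun_id (a b : 'I_n) : a != b -> edge_fun R a b a b = 1.
Proof. by move=> /negbTE ab; rewrite /edge_fun !eqxx ab addr0. Qed.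

Lemma fractionalC d g i j : fpoint d g -> fractional g i j = fractional g j i.
Proof. by case=> gC _ _ _; rewrite /fractional gC. Qed.

Lemma fractional_neq d g i j : fpoint d g -> fractional g i j -> i != j.
Proof.
by case=> _ g0 _ _; apply: contraTneq => ->; rewrite /fractional g0 ltxx.
Qed.

Lemma not_fractional d g i j : fpoint d g -> ~~ fractional g i j ->
  g i j = 0 \/ g i j = 1.
Proof.
case=> _ _ /(_ i j) /andP[g0 g1] _; rewrite /fractional negb_and -!leNgt.
case/orP=> h; [left | right]; apply/eqP; rewrite eq_le; exact/andP.
Qed.

Lemma not_fractional_int d g i j : fpoint d g -> ~~ fractional g i j ->
  g i j \is a Num.int.
Proof. by move=> gP /(not_fractional gP)[] ->; rewrite ?rpred0 ?rpred1. Qed.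

Lemma sum_fractional_int d g i : fpoint d g ->
  \sum_(j | fractional g i j) g i j \is a Num.int.
Proof.
move=> gP; have [_ _ _ /(_ i)] := gP.
rewrite (bigID (fractional g i)) /= => /(canRL (addrK _)) ->.
by rewrite rpredB ?natr_int ?rpred_sum // => j /(not_fractional_int gP).
Qed.

Lemma touchedP g i : reflect (exists j, fractional g i j) (i \in touched g).
Proof. by rewrite inE; exact: existsP. Qed.

Lemma int_gt0_lt1F (x : R) : x \is a Num.int -> 0 < x < 1 -> False.
Proof. by case/intrP => m ->; rewrite ltr0z ltrz1; lia. Qed.

(** A single fractional entry in row [i] would equal the integral sum of the fractional entries of
    that row, yet lie strictly between 0 and 1. *)
Lemma fractional_degree_ge2 d g i : fpoint d g -> i \in touched g ->
  (1 < #|[set j | fractional g i j]%SET|)%N.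
Proof.
move=> gP /touchedP[j fij].
have jD : j \in [set k | fractional g i k]%SET by rewrite inE.
rewrite (cardsD1 j) jD;
  case: (set_0Vmem ([set k | fractional g i k]%SET :\ j)%SET) => [D0|[k kD]];
    last by rewrite (cardsD1 k) kD.
exfalso; apply: (int_gt0_lt1F _ fij); have := sum_fractional_int i gP.
rewrite (bigD1 j) //= big1 ?addr0 // => k /andP[fik kj].
by move/setP: D0 => /(_ k); rewrite !inE kj fik.
Qed.

(** More fractional pairs than touched vertices would make the rows of the pair-vertex incidence
    matrix dependent, and the coefficients of a dependency form a direction excluded by rigidity. *)
Lemma card_fractional_le g d : fpoint d g -> rigid g ->
  (#|[set p | fractional g p.1 p.2 && (p.1 < p.2)%N]%SET| <= #|touched g|)%N.
Proof.
move=> gP gR; set E := [set p | _]%SET; rewrite leqNgt; apply/negP => lt.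
pose e (k : 'I_#|E|) : 'I_n * 'I_n := enum_val k.
pose M : 'M[R]_(#|E|, #|touched g|) :=
  \matrix_(k, v) ((enum_val v == (e k).1)%:R + (enum_val v == (e k).2)%:R).
have : kermx M != 0.
  rewrite -mxrank_eq0 mxrank_ker subn_eq0 -ltnNge.
  by apply: leq_ltn_trans lt; exact: rank_leq_col.
case/rowV0Pn => u /sub_kermxP uM /negP; apply; apply/eqP.
have eE k : fractional g (e k).1 (e k).2 && ((e k).1 < (e k).2)%N.
  by have := enum_valP k; rewrite inE.
pose y i j := \sum_k u 0 k * edge_fun R (e k).1 (e k).2 i j.
have y0 : forall i j, y i j = 0.
  apply: gR => [i j|i j nf|i].
  - by apply: eq_bigr => k _; rewrite edge_funC.
  - apply: big1 => k _; have /andP[fk _] := eE k.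
    rewrite edge_fun_eq0 ?mulr0 //.
      by apply: contraNneq nf => -[-> ->].
    by apply: contraNneq nf => -[-> ->]; rewrite (fractionalC _ _ gP).
  - rewrite exchange_big /=; under eq_bigr do rewrite -mulr_sumr sum_edge_fun.
    (* The columns of [M] only cover touched vertices; no fractional pair ends at another vertex. *)
    have [iT|iT] := boolP (i \in touched g); last first.
      apply: big1 => k _; have /andP[fk _] := eE k.
      have n1 : (i == (e k).1) = false.
        by apply: contraNF iT => /eqP ->; apply/touchedP; exists (e k).2.
      have n2 : (i == (e k).2) = false.
        apply: contraNF iT => /eqP ->; apply/touchedP; exists (e k).1.
        by rewrite (fractionalC _ _ gP).
      by rewrite n1 n2 addr0 mulr0.
    move/matrixP: uM => /(_ 0 (enum_rank_in iT i)); rewrite !mxE => uM.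
    by rewrite -[RHS]uM; apply: eq_bigr => k _; rewrite mxE enum_rankK_in.
(* The entry of [y] at the pair [e k] is the coefficient [u 0 k]: pairs are listed with increasing
   ends, so no other [edge_fun] of the sum is nonzero there. *)
apply/matrixP => i k; rewrite !mxE ord1 -(y0 (e k).1 (e k).2) /y (bigD1 k) //=.
have /andP[/(fractional_neq gP) nk lk] := eE k.
rewrite edge_fun_id // mulr1 big1 ?addr0 // => k' nk'.
have /andP[_ lk'] := eE k'.
rewrite edge_fun_eq0 ?mulr0 //.
  apply: contraNneq nk' => h; apply/eqP/enum_val_inj; move: h.
  by rewrite -!surjective_pairing.
by apply: contraTneq lk => h; rewrite -leqNgt; case: h => -> ->; exact: ltnW.
Qed.

(** Double counting: the degrees are at least 2 and sum to twice the number of pairs, hence to at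
    most twice the number of touched vertices, so each is exactly 2. *)
Lemma fractional_degree d g i : fpoint d g -> rigid g -> i \in touched g ->
  #|[set j | fractional g i j]%SET| = 2%N.
Proof.
move=> gP gR iT; have leE := card_fractional_le gP gR.
set E := [set p | _]%SET in leE.
have sumE : (\sum_(j in touched g) #|[set k | fractional g j k]%SET| = #|E|.*2)%N.
  rewrite -(sum_card_sym (fun i j => fractionalC i j gP)); last first.
    by move=> j; apply/negP => /(fractional_neq gP); rewrite eqxx.
  rewrite [RHS](bigID (mem (touched g))) /= [X in (_ + X)%N]big1 ?addn0 //.
  move=> j nT; apply/eqP; rewrite cards_eq0; apply/eqP/setP => k; rewrite !inE.
  by apply: contraNF nT => f; apply/touchedP; exists k.
have lif j : j \in touched g ->
  (2 <= #|[set k | fractional g j k]%SET| ?= iff (2 == #|[set k | fractional g j k]%SET|))%N.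
  by move=> jT; split=> //; exact: fractional_degree_ge2 gP jT.
have [_] := leqif_sum lif; rewrite sumE sum_nat_const.
have le2 := leqif_sum lif; rewrite sumE sum_nat_const in le2;
  have {}le2 := le2.1.
have -> : (#|touched g| * 2 == #|E|.*2)%N by rewrite eqn_leq le2 muln2 leq_double.
by move/esym/forallP => /(_ i); rewrite iT => /eqP <-.
Qed.

(** Two numbers strictly between 0 and 1 whose sum is an integer can only sum to 1. *)
Lemma sum_fractional d g i : fpoint d g -> rigid g -> i \in touched g ->
  \sum_(j | fractional g i j) g i j = 1.
Proof.
move=> gP gR iT; have := sum_fractional_int i gP.
have /eqP/cards2P[j [k [nk Ei]]] := fractional_degree gP gR iT.
have fj : fractional g i j by have := in_set2 j j k; rewrite -Ei inE eqxx.
have fk : fractional g i k by have := in_set2 k j k; rewrite -Ei inE eqxx orbT.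
have -> : \sum_(l | fractional g i l) g i l = g i j + g i k.
  rewrite (eq_bigl (fun l => l \in [set j; k]%SET)); last by move=> l;
    rewrite -Ei inE.
  by rewrite /= big_setU1 ?inE // big_set1.
move: fj fk; rewrite /fractional => fj fk /intrP[m em].
have : (0 < m%:~R :> R) && (m%:~R < (2 : int)%:~R :> R) by rewrite -em; lra.
rewrite ltr0z ltr_int => lm; rewrite em (_ : m = 1) //; lia.
Qed.

Lemma fractional_half d g i j : fpoint d g -> rigid g -> fractional g i j ->
  g i j = 2^-1.
Proof.
move=> gP gR fij; have [gC _ _ _] := gP.
pose y i j := if fractional g i j then g i j - 2^-1 else 0.
suff : y i j = 0 by rewrite /y fij; lra.
apply: (gR y) => [k l|k l /negbTE nf|k].
- by rewrite /y (fractionalC _ _ gP) gC.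
- by rewrite /y nf.
rewrite -big_mkcond /=; have [kT|kT] := boolP (k \in touched g); last first.
  by rewrite big_pred0 // => l; apply: contraNF kT => f; apply/touchedP;
    exists l.
rewrite sumrB (sum_fractional gP gR kT).
rewrite (eq_bigl (fun l => l \in [set l | fractional g k l]%SET));
  last by move=> l; rewrite inE.
by rewrite sumr_const (fractional_degree gP gR kT); lra.
Qed.

(** Allows the cycles of fractional pairs to be followed: arriving from [j], a walk leaves [i]
    through [k]. *)
Lemma fractional_other d g i j : fpoint d g -> rigid g -> fractional g i j ->
  exists2 k, k != j & forall l, fractional g i l = (l == j) || (l == k).
Proof.
move=> gP gR fij.
have iT : i \in touched g by apply/touchedP; exists j.
have /eqP/cards2P[u [v [nuv Ei]]] := fractional_degree gP gR iT.
have fE l : fractional g i l = (l == u) || (l == v) by rewrite -in_set2 -Ei inE.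
have : (j == u) || (j == v) by rewrite -fE.
case/orP => /eqP ?; subst j; [exists v | exists u] => //;
  first by rewrite eq_sym.
by move=> l; rewrite fE orbC.
Qed.

End FractionalPoints.

(** * Perturbations along 4-cycles and pairs of triangles *)

Definition square_fun (R : realType) n (a b c e i j : 'I_n) : R :=
  edge_fun R a b i j - edge_fun R b c i j
  + edge_fun R c e i j - edge_fun R e a i j.

(* The coefficient 2 makes the row sums vanish at a and a'. *)
Definition bowtie_fun (R : realType) n (a b c a' b' c' i j : 'I_n) : R :=
  2 * edge_fun R a a' i j
  - (edge_fun R a b i j + edge_fun R a c i j - edge_fun R b c i j)
  - (edge_fun R a' b' i j + edge_fun R a' c' i j - edge_fun R b' c' i j).

(** Evaluates the perturbations at named vertices, using the disequalities of the context in both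
    orientations. *)
Ltac neq_simpl :=
  rewrite /square_fun /bowtie_fun /edge_fun ?eqxx;
  repeat match goal with
  | H : is_true (?x != ?y) |- context [?x == ?y] => rewrite (negbTE H)
  | H : is_true (?x != ?y) |- context [?y == ?x] =>
      rewrite (eq_sym y x) (negbTE H)
  end;
  rewrite ?eqxx /=.

Section Switching.
Variables (R : realType) (n : nat).
Implicit Types (d : n.-tuple nat) (g y : 'I_n -> 'I_n -> R) (i j : 'I_n).

Lemma square_funC (a b c e i j : 'I_n) :
  square_fun R a b c e i j = square_fun R a b c e j i.
Proof. by rewrite /square_fun ![edge_fun _ _ _ i j]edge_funC. Qed.

(** Each vertex of the closed walk [a b c e] lies on consecutive pairs of opposite signs. *)
Lemma sum_square_fun (a b c e i : 'I_n) : \sum_j square_fun R a b c e i j = 0.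
Proof.
(* Abstracting [edge_fun] prevents the sum in its body from being split as well. *)
rewrite /square_fun; move: (@edge_fun R n) (@sum_edge_fun R n) => E sumE.
by rewrite !(sumrB, big_split) /= !sumE; ring.
Qed.

Lemma bowtie_funC (a b c a' b' c' i j : 'I_n) :
  bowtie_fun R a b c a' b' c' i j = bowtie_fun R a b c a' b' c' j i.
Proof. by rewrite /bowtie_fun ![edge_fun _ _ _ i j]edge_funC. Qed.

Lemma sum_bowtie_fun (a b c a' b' c' i : 'I_n) :
  \sum_j bowtie_fun R a b c a' b' c' i j = 0.
Proof.
rewrite /bowtie_fun; move: (@edge_fun R n) (@sum_edge_fun R n) => E sumE.
by rewrite !(sumrB, big_split) /= -mulr_sumr !sumE; ring.
Qed.

(** A case analysis for symmetric properties: only the four pairs of the walk can carry a nonzero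
    value. *)
Lemma square_fun_ind (a b c e : 'I_n) (P : 'I_n -> 'I_n -> Prop) :
  (forall i j, P i j -> P j i) -> P a b -> P b c -> P c e -> P e a ->
  (forall i j, square_fun R a b c e i j = 0 -> P i j) -> forall i j, P i j.
Proof.
move=> PC Pab Pbc Pce Pea P0 i j.
have [/orP h|] := boolP (((i, j) \in [:: (a, b); (b, c); (c, e); (e, a)])
                   || ((j, i) \in [:: (a, b); (b, c); (c, e); (e, a)])).
  by case: h; rewrite !inE => /or4P[] /eqP[-> ->] //; apply: PC.
rewrite !inE !negb_or => /andP[/and4P[? ? ? ?] /and4P[? ? ? ?]].
by apply: P0; rewrite /square_fun !edge_fun_eq0 //; ring.
Qed.

Lemma bowtie_fun_ind (a b c a' b' c' : 'I_n) (P : 'I_n -> 'I_n -> Prop) :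
  (forall i j, P i j -> P j i) -> P a a' -> P a b -> P a c -> P b c ->
  P a' b' -> P a' c' -> P b' c' ->
  (forall i j, bowtie_fun R a b c a' b' c' i j = 0 -> P i j) ->
  forall i j, P i j.
Proof.
move=> PC P1 P2 P3 P4 P5 P6 P7 P0 i j.
pose s := [:: (a, a'); (a, b); (a, c); (b, c); (a', b'); (a', c'); (b', c')].
have [/orP h|] := boolP (((i, j) \in s) || ((j, i) \in s)).
  case: h; rewrite !inE.
    by do ?[case/orP]; move=> /eqP[-> ->].
  by do ?[case/orP]; move=> /eqP[-> ->]; apply: PC.
rewrite !inE !negb_or =>
  /andP[/and5P[? ? ? ? /and3P[? ? ?]] /and5P[? ? ? ? /and3P[? ? ?]]].
by apply: P0; rewrite /bowtie_fun !edge_fun_eq0 //; ring.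
Qed.

Lemma fpoint_perturb d g (h : 'I_n -> 'I_n -> R) (t : R) : fpoint d g ->
  (forall i j, h i j = h j i) -> (forall i, h i i = 0) ->
  (forall i, \sum_j h i j = 0) ->
  (forall i j, 0 <= g i j + t * h i j <= 1) ->
  fpoint d (fun i j => g i j + t * h i j).
Proof.
move=> [gC g0 _ gS] hC h0 hS g1; split=> // [i j|i|i].
- by rewrite gC hC.
- by rewrite g0 h0; ring.
- by rewrite big_split /= -mulr_sumr gS hS; ring.
Qed.

Lemma square_fun_diag (a b c e i : 'I_n) :
  a != b -> b != c -> c != e -> e != a -> square_fun R a b c e i i = 0.
Proof.
move=> ab bc ce ea; rewrite /square_fun !edge_fun_eq0 //; first ring.
all: by rewrite xpair_eqE; apply/negP => /andP[/eqP -> /eqP h];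
  move: ab bc ce ea; rewrite h eqxx.
Qed.

Lemma bowtie_fun_diag (a b c a' b' c' i : 'I_n) :
  a != a' -> a != b -> a != c -> b != c -> a' != b' -> a' != c' -> b' != c' ->
  bowtie_fun R a b c a' b' c' i i = 0.
Proof.
move=> h1 h2 h3 h4 h5 h6 h7; rewrite /bowtie_fun !edge_fun_eq0 //; first ring.
all: rewrite xpair_eqE; apply/negP => /andP[/eqP -> /eqP h].
all: by move: h1 h2 h3 h4 h5 h6 h7; rewrite h eqxx.
Qed.

(** A smaller fractional support leaves fewer directions to exclude. *)
Lemma rigid_sub g g' : (forall i j, fractional g' i j -> fractional g i j) ->
  rigid g -> rigid g'.
Proof.
move=> sub gR y yC y0 yS; apply: (gR y) => // i j nf; apply: y0.
by apply: contraNN nf => /sub.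
Qed.

Lemma fractional_degree2 d g (i j k l : 'I_n) : fpoint d g -> rigid g ->
  j != k ->
  fractional g i j -> fractional g i k -> fractional g i l ->
    (l == j) || (l == k).
Proof.
move=> gP gR jk fij fik; have [m _ fE] := fractional_other gP gR fij.
by rewrite fE; move: fik; rewrite fE eq_sym (negbTE jk) => /= /eqP ->.
Qed.

(** The vertex [b] loses both of its fractional pairs and no vertex becomes newly touched; [e a]
    becomes fractional, so this step never ends at an integral point. *)
Lemma square_step d g (a b c e : 'I_n) : fpoint d g -> rigid g ->
  fractional g a b -> fractional g b c -> fractional g c e -> a != c ->
    b != e -> a != e ->
  exists g', [/\ fpoint d g', rigid g', touched g' \proper touched g
               & exists i, i \in touched g'].
Proof.
move=> gP gR fab fbc fce ac be ae; have [gC _ g01 _] := gP.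
have ab := fractional_neq gP fab; have bc := fractional_neq gP fbc.
have ce := fractional_neq gP fce; have ea : e != a by rewrite eq_sym.
pose h := square_fun R a b c e.
have hab : h a b = 1 by rewrite /h; neq_simpl; ring.
have hbc : h b c = -1 by rewrite /h; neq_simpl; ring.
have hce : h c e = 1 by rewrite /h; neq_simpl; ring.
have hea : h e a = -1 by rewrite /h; neq_simpl; ring.
have hC : forall i j, h i j = h j i by move=> i j; exact: square_funC.
have hS : forall i, \sum_j h i j = 0 by move=> i; exact: sum_square_fun.
(* Otherwise all four pairs are fractional and [h] itself violates rigidity. *)
have nfea : ~~ fractional g e a.
  apply/negP => fea; suff : h a b = 0 by rewrite hab; lra.
  apply: (gR h) => //.
  apply: (@square_fun_ind a b c e) => [i j|||||i j];
    rewrite ?fab ?fbc ?fce ?fea //.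
  by rewrite (fractionalC _ _ gP) hC.
(* As [g e a] is 0 or 1, [t] is -1/2 or 1/2: it brings [e a] to 1/2 and the three halves to 0 or
   1. *)
pose t := g e a - 2^-1; pose g' i j := g i j + t * h i j.
have gab := fractional_half gP gR fab; have gbc := fractional_half gP gR fbc.
have gce := fractional_half gP gR fce; have gea := not_fractional gP nfea.
have g'P : fpoint d g'.
  apply: fpoint_perturb => //; first by move=> i; exact: square_fun_diag.
  apply: (@square_fun_ind a b c e) => [i j|||||i j]; rewrite -/(h _ _).
  - by rewrite gC hC.
  - by rewrite hab gab /t; case: gea => ->; lra.
  - by rewrite hbc gbc /t; case: gea => ->; lra.
  - by rewrite hce gce /t; case: gea => ->; lra.
  - by rewrite hea /t; lra.
  - by move=> ->; rewrite mulr0 addr0.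
have nf'ab : ~~ fractional g' a b.
  by rewrite /fractional /g' hab gab /t; case: gea => ->; apply/negP; lra.
have nf'bc : ~~ fractional g' b c.
  by rewrite /fractional /g' hbc gbc /t; case: gea => ->; apply/negP; lra.
have nf'ce : ~~ fractional g' c e.
  by rewrite /fractional /g' hce gce /t; case: gea => ->; apply/negP; lra.
have f'ea : fractional g' e a by rewrite /fractional /g' hea /t; lra.
exists g'; split => //.
- move=> y yC y0 yS.
  (* The term in [h] cancels [y] at [e a], the one pair fractional for [g'] but not for [g]; at
     [a b], where [y] vanishes, the identity then gives [y e a = 0]. *)
  have z0 i j : y i j + y e a * h i j = 0.
    apply: (gR (fun i j => y i j + y e a * h i j)) => [k l|k l|k].
    + by rewrite yC hC.
    + move: k l; apply: (@square_fun_ind a b c e) => [k l|||||k l].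
      * by rewrite (fractionalC _ _ gP) yC hC.
      * by rewrite fab.
      * by rewrite fbc.
      * by rewrite fce.
      * by rewrite hea mulrN1 subrr.
      * rewrite -/(h k l) => hkl nf; rewrite hkl y0 ?mulr0 ?addr0 //.
        by rewrite /fractional /g' hkl mulr0 addr0.
    + by rewrite big_split /= -mulr_sumr yS hS mulr0 addr0.
  have yea : y e a = 0 by have := z0 a b; rewrite y0 // hab; lra.
  by move=> i j; have := z0 i j; rewrite yea mul0r addr0.
- have sub i j : fractional g' i j -> (i != b) && (i \in touched g).
    (* The stronger claim is symmetric in [i] and [j], as [square_fun_ind] requires. *)
    suff : fractional g' i j ->
      [&& i != b, j != b, i \in touched g & j \in touched g].
      by move=> + f => /(_ f) /and4P[-> _ -> _].
    apply/implyP; move: i j; apply: (@square_fun_ind a b c e) => [k l|||||k l].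
    + by rewrite (fractionalC _ _ g'P) => /implyP H;
      apply/implyP => /H /and4P[-> -> -> ->].
    + by rewrite (negbTE nf'ab).
    + by rewrite (negbTE nf'bc).
    + by rewrite (negbTE nf'ce).
    + rewrite f'ea /= ab (eq_sym e) be /=; apply/andP; split; apply/touchedP.
        by exists c; rewrite (fractionalC _ _ gP).
      by exists b.
    + rewrite -/(h k l) => hkl; apply/implyP;
      rewrite /fractional /g' hkl mulr0 addr0 -/(fractional g k l) => f.
      have fba : fractional g b a by rewrite (fractionalC _ _ gP).
      apply/and4P; split.
      (* The only fractional pairs of [g] at [b] are [a b] and [b c], where [h] is nonzero. *)
      * apply: contra_eq_neq hkl => kb; subst k.
        by case/orP: (fractional_degree2 gP gR ac fba fbc f) => /eqP ->;
          rewrite ?hbc 1?hC ?hab; lra.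
      * apply: contra_eq_neq hkl => lb; subst l; move: f;
        rewrite (fractionalC _ _ gP) => f.
        by case/orP: (fractional_degree2 gP gR ac fba fbc f) => /eqP ->;
          rewrite ?hab 1?hC ?hbc; lra.
      * by apply/touchedP; exists l.
      * by apply/touchedP; exists k; rewrite (fractionalC _ _ gP).
  apply/properP; split.
    by apply/fintype.subsetP => i /touchedP[j /sub /andP[]].
  exists b; first by apply/touchedP; exists c.
  by apply/touchedP => -[j /sub]; rewrite eqxx.
- by exists e; apply/touchedP; exists a.
Qed.

End Switching.

(** * From a rigid fractional point to a realization with a (3,3)-blossom *)

Section Reduction.
Variables (R : realType) (n : nat).
Implicit Types (d : n.-tuple nat) (g y : 'I_n -> 'I_n -> R) (i j : 'I_n).
Implicit Types (G : sgraph n).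

Lemma degreeE G i : (degree G i)%:R = \sum_j (G i j)%:R :> R.
Proof.
rewrite /degree -sum1_card natr_sum big_mkcond /=.
by apply: eq_bigr => j _; rewrite inE; case: (G i j).
Qed.

Lemma realization_fpoint d G : realization d G ->
  fpoint d (fun i j => (G i j)%:R : R).
Proof.
move=> dG; split=> [i j|i|i j|i]; first by rewrite adj_sym.
- by rewrite adj_irrefl.
- by rewrite ler0n lern1 leq_b1.
- by rewrite -degreeE dG.
Qed.

Lemma fpoint_realization d g : fpoint d g ->
  (forall i j, ~~ fractional g i j) ->
  exists2 G, realization d G & forall i j, g i j = (G i j)%:R.
Proof.
move=> gP nf; have [gC g0 _ gS] := gP.
have sC : symmetric (fun i j => g i j == 1) by move=> i j; rewrite gC.
have s0 : irreflexive (fun i j => g i j == 1).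
  by move=> i; rewrite g0 eq_sym oner_eq0.
have gE i j : g i j = (g i j == 1)%:R.
  by case: (not_fractional gP (nf i j)) => ->; rewrite ?eqxx // eq_sym oner_eq0.
exists (SGraph sC s0) => // i; apply/eqP; rewrite -(eqr_nat R) degreeE -gS.
by apply/eqP/eq_bigr => j _; rewrite [RHS]gE.
Qed.

Lemma graphic_even d : graphic d -> ~~ odd (\sum_i tnth d i).
Proof.
case=> G dG; rewrite -(eq_bigr _ (fun i _ => dG i)) /degree.
by rewrite (sum_card_sym (@adj_sym _ G) (@adj_irrefl _ G)) odd_double.
Qed.

(** By [sum_fractional], [tnth d i] is the number of ones in row [i], plus 1 if [i] is touched. The
    degrees have an even sum, and so do the numbers of ones, by the handshake count. *)
Lemma touched_even d g : graphic d -> fpoint d g -> rigid g ->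
  ~~ odd #|touched g|.
Proof.
move=> /graphic_even ev gP gR; have [gC g0 _ gS] := gP.
have sC : symmetric (fun i j => g i j == 1) by move=> i j; rewrite gC.
have s0 : irreflexive (fun i j => g i j == 1).
  by move=> i; rewrite g0 eq_sym oner_eq0.
suff dE i : tnth d i = (#|[set j | (g i j == 1)%R]%SET| + (i \in touched g))%N.
  move: ev; rewrite (eq_bigr _ (fun i _ => dE i)) big_split /=.
  rewrite (sum_card_sym sC s0) oddD odd_double /=.
  by rewrite -(big_mkcond (mem (touched g)) (fun=> 1%N)) sum1_card.
apply/eqP; rewrite -(eqr_nat R) -gS (bigID (fractional g i)) /= addrC natrD.
apply/eqP; congr (_ + _).
  rewrite -sum1_card natr_sum big_mkcond /= [RHS]big_mkcond /=.
  apply: eq_bigr => j _; rewrite inE; case: ifP => [nf|/negbFE f].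
    by case: (not_fractional gP nf) => ->; rewrite ?eqxx // eq_sym oner_eq0.
  by move: f; rewrite /fractional; case: eqP => // ->; rewrite ltxx andbF.
case: (boolP (i \in touched g)) => [/(sum_fractional gP gR) //|nT].
rewrite big_pred0 // => j; apply: contraNF nT => f.
by apply/touchedP; exists j.
Qed.

Definition triangle g (a b c : 'I_n) : Prop :=
  [/\ fractional g a b, fractional g a c & fractional g b c].

Lemma triangle_or_step d g i : fpoint d g -> rigid g -> i \in touched g ->
  (exists b c, b != c /\ triangle g i b c) \/
  exists g', [/\ fpoint d g', rigid g', touched g' \proper touched g
               & exists j, j \in touched g'].
Proof.
move=> gP gR /touchedP[b fib].
have [c cb fE] := fractional_other gP gR fib.
have fbi : fractional g b i by rewrite (fractionalC _ _ gP).
have fic : fractional g i c by rewrite fE eqxx orbT.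
have [e ei fE'] := fractional_other gP gR fbi.
have fbe : fractional g b e by rewrite fE' eqxx orbT.
(* If the other neighbours of [i] and [b] coincide they close a triangle; otherwise [c i b e] is a
   path of four distinct vertices. *)
have [ec|ce] := eqVneq c e.
  by left; exists b, c; rewrite eq_sym; split=> //; split=> //; rewrite ec.
right; apply: (@square_step _ _ d g c i b e) => //; last by rewrite eq_sym.
by rewrite (fractionalC _ _ gP).
Qed.

(** All seven pairs of the two joined triangles become integral, with values alternating along the
    blossom sequence; rigidity persists because no pair becomes fractional. *)
Lemma bowtie_step d g (a b c a' b' c' : 'I_n) : fpoint d g -> rigid g ->
  uniq [:: a; b; c; a'; b'; c'] -> triangle g a b c -> triangle g a' b' c' ->
  exists g', [/\ fpoint d g', rigid g', touched g' \proper touched g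
    & (forall i j, ~~ fractional g' i j) ->
      exists2 G, realization d G & has_blossom G 3 3].
Proof.
move=> gP gR U [fab fac fbc] [fab' fac' fbc']; have [gC _ g01 _] := gP.
have := U; rewrite /= !inE !negb_or.
case/and5P=> /and5P[ab ac aa' ab' ac'] /and4P[bc ba' bb' bc']
  /and3P[ca' cb' cc'].
case/andP=> a'b' a'c' /andP[b'c' _].
pose h := bowtie_fun R a b c a' b' c'.
have haa' : h a a' = 2 by rewrite /h; neq_simpl; ring.
have hab : h a b = -1 by rewrite /h; neq_simpl; ring.
have hac : h a c = -1 by rewrite /h; neq_simpl; ring.
have hbc : h b c = 1 by rewrite /h; neq_simpl; ring.
have hab' : h a' b' = -1 by rewrite /h; neq_simpl; ring.
have hac' : h a' c' = -1 by rewrite /h; neq_simpl; ring.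
have hbc' : h b' c' = 1 by rewrite /h; neq_simpl; ring.
have hC : forall i j, h i j = h j i by move=> i j; exact: bowtie_funC.
have hS : forall i, \sum_j h i j = 0 by move=> i; exact: sum_bowtie_fun.
(* The two fractional pairs at [a] already go to [b] and [c]. *)
have nfaa' : ~~ fractional g a a'.
  apply/negP => f; case/orP: (fractional_degree2 gP gR bc fab fac f) => /eqP E.
    by rewrite E eqxx in ba'.
  by rewrite E eqxx in ca'.
have gaa' := not_fractional gP nfaa'.
(* [t] is 1/2 or -1/2, according to the integer [g a a']; it flips [a a'] and rounds the six
   halves. *)
pose t := 2^-1 - g a a'; pose g' i j := g i j + t * h i j.
have gab := fractional_half gP gR fab; have gac := fractional_half gP gR fac.
have gbc := fractional_half gP gR fbc; have gab' := fractional_half gP gR fab'.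
have gac' := fractional_half gP gR fac';
  have gbc' := fractional_half gP gR fbc'.
have vaa' : g' a a' = 1 - g a a' by rewrite /g' haa' /t; lra.
have vab : g' a b = g a a' by rewrite /g' hab gab /t; lra.
have vac : g' a c = g a a' by rewrite /g' hac gac /t; lra.
have vbc : g' b c = 1 - g a a' by rewrite /g' hbc gbc /t; lra.
have vab' : g' a' b' = g a a' by rewrite /g' hab' gab' /t; lra.
have vac' : g' a' c' = g a a' by rewrite /g' hac' gac' /t; lra.
have vbc' : g' b' c' = 1 - g a a' by rewrite /g' hbc' gbc' /t; lra.
have g'P : fpoint d g'.
  apply: fpoint_perturb => //; first by move=> i; exact: bowtie_fun_diag.
  have := g01 a a'.
  move=> s01; apply: (@bowtie_fun_ind R n a b c a' b' c') => [i j|||||||| i j];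
    rewrite -/(g' _ _) ?vaa' ?vab ?vac ?vbc ?vab' ?vac' ?vbc' //; try lra.
    by rewrite /g' gC hC.
  by move=> hij; rewrite /g' [h i j]hij mulr0 addr0.
have nf' u v : g' u v = g a a' \/ g' u v = 1 - g a a' -> ~~ fractional g' u v.
  by rewrite /fractional; case=> ->; case: gaa' => ->; apply/negP; lra.
have hN x : h a x = 0 -> fractional g a x -> False.
  by move=> hx /(fractional_degree2 gP gR bc fab fac) /orP[] /eqP xE; move: hx;
    rewrite xE ?hab ?hac; lra.
have sub i j : fractional g' i j -> [&& fractional g i j, i != a & j != a].
  move: i j; apply: (@bowtie_fun_ind R n a b c a' b' c') => [i j|||||||| i j].
  - rewrite (fractionalC _ _ g'P) (fractionalC _ _ gP) =>
    H /H /and3P[-> -> ->] //.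
  - by rewrite (negbTE (nf' _ _ (or_intror vaa'))).
  - by rewrite (negbTE (nf' _ _ (or_introl vab))).
  - by rewrite (negbTE (nf' _ _ (or_introl vac))).
  - by rewrite (negbTE (nf' _ _ (or_intror vbc))).
  - by rewrite (negbTE (nf' _ _ (or_introl vab'))).
  - by rewrite (negbTE (nf' _ _ (or_introl vac'))).
  - by rewrite (negbTE (nf' _ _ (or_intror vbc'))).
  move=> hij; have -> : fractional g' i j = fractional g i j.
    by rewrite /fractional /g' [h i j]hij mulr0 addr0.
  move=> f; rewrite f /=; apply/andP; split; apply/eqP => E.
    by apply: (hN j); rewrite -E; [exact: hij | exact: f].
  by apply: (hN i); rewrite -E; [rewrite hC;
    exact: hij | rewrite (fractionalC _ _ gP)].
exists g'; split=> //.
- by apply: rigid_sub gR => i j /sub /and3P[].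
- apply/properP; split.
    by apply/fintype.subsetP => i /touchedP[j /sub /and3P[f _ _]];
      apply/touchedP; exists j.
  exists a; first by apply/touchedP; exists b.
  by apply/touchedP => -[j /sub]; rewrite eqxx andbF.
- move=> /(fpoint_realization g'P)[G dG GE]; exists G => //.
  exists a, [:: b; c], a', [:: b'; c']; split=> //=.
  have E (i j k l : 'I_n) : g' i j = 1 - g' k l -> G i j != G k l.
    by rewrite !GE; case: (G i j); case: (G k l) => //= H; exfalso; move: H;
      rewrite ?mulr1n ?mulr0n; lra.
  rewrite (adj_sym G c a) (adj_sym G c' a') !E
    // ?vaa' ?vab ?vac ?vbc ?vab' ?vac' ?vbc' //; lra.
Qed.

(** Each vertex of the triangle already has its two fractional neighbours in it, so the triangle is
    a whole component. *)
Lemma triangle_nbr d g (a b c x : 'I_n) : fpoint d g -> rigid g -> b != c ->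
  triangle g a b c -> x \in [:: a; b; c] ->
  forall z, fractional g x z -> z \in [:: a; b; c].
Proof.
move=> gP gR bc [fab fac fbc]; have ab := fractional_neq gP fab;
  have ac := fractional_neq gP fac.
have := (fab, fac, fbc);
  rewrite (fractionalC _ _ gP) (fractionalC a c gP) (fractionalC b c gP) =>
    -[[fba fca] fcb].
rewrite !inE => /or3P[] /eqP -> z; rewrite !inE.
- by move=> /(fractional_degree2 gP gR bc fab fac) /orP[] ->; rewrite ?orbT.
- by move=> /(fractional_degree2 gP gR ac fba fbc) /orP[] ->; rewrite ?orbT.
- by move=> /(fractional_degree2 gP gR ab fca fcb) /orP[] ->; rewrite ?orbT.
Qed.

(** Strong induction on the number of touched vertices. Only [bowtie_step] can exhaust them, and
    then it delivers the blossom. *)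
Lemma rigid_blossom d g i : graphic d -> fpoint d g -> rigid g ->
  i \in touched g -> exists2 G, realization d G & has_blossom G 3 3.
Proof.
move=> hd; have [m] := ubnP #|touched g|.
elim: m => // m IH in g i *; rewrite ltnS => lem gP gR iT.
have next g' : fpoint d g' -> rigid g' -> touched g' \proper touched g ->
    (exists j, j \in touched g') ->
      exists2 G, realization d G & has_blossom G 3 3.
  move=> g'P g'R /proper_card lt [j jT]; apply: (IH g' j) => //.
  exact: leq_trans lem.
have [[b [c [bc T]]]|[g' []]] := triangle_or_step gP gR iT; last exact: next.
have [fib fic fbc] := T.
have U : uniq [:: i; b; c].
  by rewrite /= !inE negb_or (fractional_neq gP fib) (fractional_neq gP fic) bc.
(* Otherwise the touched vertices are exactly the three of the triangle, against [touched_even]. *)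
have [i' i'T i'N] : exists2 i', i' \in touched g & i' \notin [:: i; b; c].
  apply/exists_inP; rewrite -negb_forall_in; apply/negP => /forall_inP sub.
  have := touched_even hd gP gR; suff -> : #|touched g| = 3%N by [].
  rewrite -[3%N]/(size [:: i; b; c]) -(card_uniqP U); apply: eq_card => x;
    apply/idP/idP; first exact: sub.
  rewrite !inE => /or3P[] /eqP ->; apply/existsP.
  - by exists b.
  - by exists c.
  - by exists b; rewrite (fractionalC _ _ gP).
have [[b' [c' [bc' T']]]|[g' []]] := triangle_or_step gP gR i'T;
  last exact: next.
have [fib' fic' fbc'] := T'.
(* The first triangle is closed under fractional neighbours, so [b'] and [c'] lie outside it as [i']
   does. *)
have out x : fractional g x i' -> x \notin [:: i; b; c].
  by move=> f; apply: contra i'N => xN; apply: triangle_nbr f => //; eauto.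
have U6 : uniq [:: i; b; c; i'; b'; c'].
  rewrite -[_ :: _]/([:: i; b; c] ++ [:: i'; b'; c']) cat_uniq U /=.
  rewrite (negbTE i'N) (negbTE (out b' _)) ?(negbTE (out c' _)) ?(fractionalC _ i' gP) //=.
  by rewrite !inE negb_or (fractional_neq gP fib') (fractional_neq gP fic') bc'.
have [g' [g'P g'R lt fin]] := bowtie_step gP gR U6 T T'.
have [T0|[j jT]] := set_0Vmem (touched g'); last by apply: (next g') => //;
  exists j.
apply: fin => k l; apply/negP => f.
by move/setP/(_ k): T0; rewrite !inE => /existsP; apply; exists l.
Qed.

End Reduction.

(** * Vertices of the polytope as rigid matrices *)

Definition coords (R : realType) n (x : pair_space R n) (i j : 'I_n) : R :=
  \sum_(e : upair n | val e == [set i; j]%SET) x e.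

(** For [e = {i, j}] and a symmetric [g] with zero diagonal the double sum counts [g i j] twice; no
    order on the ends of [e] has to be chosen. *)
Definition of_coords (R : realType) n (g : 'I_n -> 'I_n ->
  R) : pair_space R n :=
  [ffun e : upair n =>
     2^-1 * \sum_(i | i \in val e) \sum_(j | j \in val e) g i j].

Section Vertices.
Variables (R : realType) (n : nat).
Implicit Types (d : n.-tuple nat) (g y : 'I_n -> 'I_n -> R) (i j : 'I_n).
Implicit Types (e : upair n) (x : pair_space R n).

Lemma upair_set e : exists i j, i != j /\ val e = [set i; j]%SET.
Proof. exact/cards2P/(valP e). Qed.

Lemma set_upair i j : i != j -> exists e, val e = [set i; j]%SET.
Proof.
move=> ij; have c2 : #|[set i; j]%SET| == 2%N by rewrite cards2 ij.
by exists (exist _ [set i; j]%SET c2).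
Qed.

Lemma coordsE x e i j : val e = [set i; j]%SET -> coords x i j = x e.
Proof. by rewrite /coords => <-; rewrite (big_pred1 e) // => e';
  rewrite val_eqE. Qed.

Lemma coordsC x i j : coords x i j = coords x j i.
Proof. by rewrite /coords finset.setUC. Qed.

Lemma coords_diag x i : coords x i i = 0.
Proof.
rewrite /coords big_pred0 // => e; apply/negP => /eqP ei.
by have := valP e; rewrite /= ei cards2 eqxx.
Qed.

Lemma sum_coords x i : \sum_j coords x i j = \sum_(e : upair n | i \in val e) x e.
Proof.
pose P e := i \in val e.
rewrite /coords (exchange_big_dep P); last first.
  by move=> j e _ /eqP; rewrite /P => ->; rewrite !inE eqxx.
apply: eq_bigr => e; rewrite /P; have [u [v [uv ->]]] := upair_set e.
have pick (a b : 'I_n) : a != b -> \sum_(j | [set a; b]%SET == [set a;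
  j]%SET) (x e : R) = x e.
  move=> ab; rewrite (big_pred1 b) // => j; apply/eqP/eqP => [E|-> //].
  have : b \in [set a; j]%SET by rewrite -E !inE eqxx orbT.
  by rewrite !inE eq_sym (negbTE ab) => /eqP ->.
by rewrite !inE => /orP[] /eqP ->; [|rewrite finset.setUC];
  rewrite pick // eq_sym.
Qed.

Lemma of_coordsE g e i j : (forall i j, g i j = g j i) ->
  (forall i, g i i = 0) ->
  i != j -> val e = [set i; j]%SET -> of_coords g e = g i j.
Proof.
move=> gC g0 ij ve; rewrite ffunE ve.
have S (F : 'I_n -> R) : \sum_(k | k \in [set i; j]%SET) F k = F i + F j.
  by rewrite big_setU1 ?inE // big_set1.
by rewrite !S !g0 (gC j i); lra.
Qed.

Lemma coords_of g i j : (forall i j, g i j = g j i) -> (forall i, g i i = 0) ->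
  coords (of_coords g) i j = g i j.
Proof.
move=> gC g0; have [->|ij] := eqVneq i j; first by rewrite coords_diag g0.
by have [e ve] := set_upair ij; rewrite (coordsE _ ve) (of_coordsE gC g0 ij ve).
Qed.

Lemma coords_fpoint d x : degree_polytope R d x -> fpoint d (coords x).
Proof.
case=> xS x01; split=> [i j|i|i j|i].
- exact: coordsC.
- exact: coords_diag.
- have [->|/set_upair[e ve]] := eqVneq i j; first by rewrite coords_diag; lra.
  by rewrite (coordsE _ ve); exact: x01.
- by rewrite sum_coords; exact: xS.
Qed.

Lemma of_coords_polytope d g : fpoint d g -> degree_polytope R d (of_coords g).
Proof.
case=> gC g0 g01 gS; split=> [j|e].
  by rewrite -sum_coords -gS; apply: eq_bigr => i _; exact: coords_of.
by have [i [j [ij ve]]] := upair_set e; rewrite (of_coordsE gC g0 ij ve);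
  exact: g01.
Qed.

(** [x] is the midpoint of the two points reached by a small step along [y] and along [- y];
    extremality makes both equal to [x]. *)
Lemma vertex_rigid d x : is_vertex (degree_polytope R d) x -> rigid (coords x).
Proof.
case=> xP xV; set g := coords x => y yC y0 yS.
have gP : fpoint d g := coords_fpoint xP; have [gC g0 g01 _] := gP.
(* The step M^-1 keeps g + y / M and g - y / M inside the box. *)
pose m i j := Num.min (g i j) (1 - g i j).
pose M := 1 + \sum_i \sum_j `|y i j| / m i j.
have m0 i j : 0 <= m i j by have := g01 i j; rewrite le_min; lra.
have M1 i j : `|y i j| / m i j + 1 <= M.
  have p0 k l : 0 <= `|y k l| / m k l by rewrite divr_ge0.
  rewrite /M addrC lerD2l (bigD1 i) //= (bigD1 j) //= -addrA lerDl addr_ge0 //.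
    by apply: sumr_ge0 => l _.
  by apply: sumr_ge0 => k _; apply: sumr_ge0.
have M0 : 0 < M by apply: ltr_pwDl => //; do 2!apply: sumr_ge0 => ? _;
  rewrite divr_ge0.
(* At integral entries [y i j] is 0 and the bound is trivial; the quotient by [m i j] is only used
   at fractional entries, where [m i j] is positive. *)
have ym i j : `|y i j| <= m i j * M.
  have [f|nf] := boolP (fractional g i j); last first.
    by rewrite y0 // normr0 mulr_ge0 // ltW.
  have m1 : 0 < m i j by move: f; rewrite /fractional lt_min; lra.
  by rewrite mulrC -ler_pdivrMr //; have := M1 i j; lra.
have ydiag i : y i i = 0 by apply: y0; rewrite /fractional g0 ltxx.
have uP (t : R) : `|t| = M^-1 -> fpoint d (fun i j => g i j + t * y i j).
  move=> tM; apply: fpoint_perturb => // i j.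
  have : `|t * y i j| <= m i j.
    by rewrite normrM tM mulrC ler_pdivrMr.
  by rewrite le_min !ler_norml; lra.
have tP : `|M^-1| = M^-1 by rewrite ger0_norm // invr_ge0 ltW.
have tN : `|- M^-1| = M^-1 by rewrite normrN.
have half01 : 0 < (2^-1 : R) < 1 by lra.
have [|ux _] := xV _ _ _ (of_coords_polytope (uP _ tP)) (of_coords_polytope (uP _ tN)) half01.
  apply/ffunP => e; rewrite !ffunE; have [i [j [ij ve]]] := upair_set e.
  have [pC p0 _ _] := uP _ tP; have [qC q0 _ _] := uP _ tN.
  have := of_coordsE pC p0 ij ve; have := of_coordsE qC q0 ij ve.
  rewrite !ffunE => -> ->; rewrite -(coordsE x ve) -/g /GRing.scale /=.
  by lra.
move=> i j; have [->|ij] := eqVneq i j; first exact: ydiag.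
have [e ve] := set_upair ij; have [pC p0 _ _] := uP _ tP.
move/ffunP/(_ e): ux; rewrite (of_coordsE pC p0 ij ve) -(coordsE x ve) -/g.
rewrite -[RHS]addr0 => /addrI /eqP; rewrite mulf_eq0 invr_eq0.
by rewrite (gt_eqF M0) /= => /eqP.
Qed.

Lemma convex_01 (a b c t : R) : 0 < t < 1 -> 0 <= b <= 1 -> 0 <= c <= 1 ->
  a = t * b + (1 - t) * c -> a = 0 \/ a = 1 -> b = a.
Proof.
by move=> t01 b01 c01 E [] a0; rewrite a0 in E *; nra.
Qed.

(** Where [g] is 0 or 1, both points of a convex combination equal to [g] agree with it; their
    differences from [g] are thus directions excluded by rigidity. *)
Lemma rigid_vertex d g : fpoint d g -> rigid g ->
  is_vertex (degree_polytope R d) (of_coords g).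
Proof.
move=> gP gR; have [gC g0 _ gS] := gP; split; first exact: of_coords_polytope.
have main (y z : pair_space R n) (t : R) : degree_polytope R d y ->
  degree_polytope R d z ->
    0 < t < 1 -> of_coords g = t *: y + (1 - t) *: z -> y = of_coords g.
  move=> yP zP t01 E.
  have [yC y0 y01 yS] := coords_fpoint yP;
    have [zC z0 z01 _] := coords_fpoint zP.
  have gyz i j : g i j = t * coords y i j + (1 - t) * coords z i j.
    have [->|ij] := eqVneq i j; first by rewrite g0 y0 z0; ring.
    have [e ve] := set_upair ij;
      rewrite !(coordsE _ ve) -(of_coordsE gC g0 ij ve) E.
    by rewrite !ffunE.
  have D0 i j : coords y i j - g i j = 0.
    apply: (gR (fun i j => coords y i j - g i j)) => [k l|k l nf|k].
    - by rewrite yC gC.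
    - have gkl := not_fractional gP nf.
      by rewrite (convex_01 t01 (y01 k l) (z01 k l) (gyz k l) gkl) subrr.
    - by rewrite sumrB yS gS subrr.
  apply/ffunP => e; have [i [j [ij ve]]] := upair_set e.
  by rewrite (of_coordsE gC g0 ij ve) -(coordsE y ve); apply/eqP;
    rewrite -subr_eq0 D0.
move=> y z t yP zP t01 E; split; first exact: main yP zP t01 E.
apply: (main z y (1 - t)) => //; first lra.
by rewrite E addrC subKr.
Qed.

Lemma blossom33_not_decisive d (G : sgraph n) :
  realization d G -> has_blossom G 3 3 -> ~ decisive R d.
Proof.
move=> dG [a [v [a' [v' [sv sv' U S]]]]].
case: v sv U S => [|b [|c [|]]] // _;
  case: v' sv' => [|b' [|c' [|]]] // _ U S dec.
have := U; rewrite /= !inE !negb_or.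
case/and5P=> /and5P[ab ac aa' ab' ac'] /and4P[bc ba' bb' bc']
  /and3P[ca' cb' cc'].
case/andP=> a'b' a'c' /andP[b'c' _].
have gP := realization_fpoint R dG; pose g i j : R := (G i j)%:R.
have {}gP : fpoint d g := gP; have [gC _ g01 _] := gP.
pose h := bowtie_fun R a b c a' b' c'.
have haa' : h a a' = 2 by rewrite /h; neq_simpl; ring.
have hab : h a b = -1 by rewrite /h; neq_simpl; ring.
have hac : h a c = -1 by rewrite /h; neq_simpl; ring.
have hbc : h b c = 1 by rewrite /h; neq_simpl; ring.
have hab' : h a' b' = -1 by rewrite /h; neq_simpl; ring.
have hac' : h a' c' = -1 by rewrite /h; neq_simpl; ring.
have hbc' : h b' c' = 1 by rewrite /h; neq_simpl; ring.
have hC : forall i j, h i j = h j i by move=> i j; exact: bowtie_funC.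
have hS : forall i, \sum_j h i j = 0 by move=> i; exact: sum_bowtie_fun.
have opp (b1 b2 : bool) : b1 != b2 -> (b2%:R : R) = 1 - b1%:R.
  by case: b1 b2 => [] [] // _; rewrite ?subrr ?subr0.
move: S; rewrite /= !(adj_sym G c a) !(adj_sym G c' a') andbT.
case/and5P=> /opp v1 /opp v2 /opp v3 /opp v4 /andP[/opp v5 /opp v6].
(* [t] is 1/2 or -1/2 as [a b] is an edge or not; it brings the six triangle pairs to 1/2 and flips
   [a a']. *)
pose t := g a b - 2^-1; pose g' i j := g i j + t * h i j.
have s01 : g a b = 0 \/ g a b = 1 by rewrite /g; case: (G a b); [right | left].
have vaa' : g' a a' = g a b by rewrite /g' haa' /t /g; lra.
have vab : g' a b = 2^-1 by rewrite /g' hab /t /g; lra.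
have vac : g' a c = 2^-1 by rewrite /g' hac /t /g; lra.
have vbc : g' b c = 2^-1 by rewrite /g' hbc /t /g; lra.
have vab' : g' a' b' = 2^-1 by rewrite /g' hab' /t /g; lra.
have vac' : g' a' c' = 2^-1 by rewrite /g' hac' /t /g; lra.
have vbc' : g' b' c' = 2^-1 by rewrite /g' hbc' /t /g; lra.
have g'P : fpoint d g'.
  apply: fpoint_perturb => //; first by move=> i; exact: bowtie_fun_diag.
  apply: (@bowtie_fun_ind R n a b c a' b' c') => [i j|||||||| i j];
    rewrite -/(g' _ _) ?vaa' ?vab ?vac ?vbc ?vab' ?vac' ?vbc' //; try lra.
    by rewrite /g' gC hC.
  by move=> hij; rewrite /g' [h i j]hij mulr0 addr0.
have fab : g' a b = 0 \/ g' a b = 1.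
  have [e ve] := set_upair ab; have [g'C g'0 _ _] := g'P.
  rewrite -(of_coordsE g'C g'0 ab ve); apply: dec;
    apply: rigid_vertex => // y yC y0 yS.
  have yaa' : y a a' = 0.
    by apply: y0; rewrite /fractional vaa'; case: s01 => ->;
      rewrite ltxx ?andbF.
  have yoff i j : h i j = 0 -> y i j = 0.
    move=> hij; apply: y0; rewrite /fractional /g' hij mulr0 addr0 /g.
    by case: (G i j); rewrite ?ltxx ?andbF.
  have only2 (p q r : 'I_n) : q != r -> (forall j, j != q -> j != r ->
    y p j = 0) ->
      y p q + y p r = 0.
    move=> qr yp; have := yS p;
      rewrite (bigD1 q) //= (bigD1 r) 1?eq_sym //= big1 ?addr0 //.
    by move=> j /andP[jq jr]; apply: yp.
  (* As [y] vanishes at the integral pair [a a'], each of the six vertices is left with its two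
     triangle pairs. *)
  have Ea : y a b + y a c = 0.
    apply: only2 => // j jb jc; have [->//|ja'] := eqVneq j a'; apply: yoff.
    have [->|ja] := eqVneq j a; first exact: bowtie_fun_diag.
    by rewrite /h; neq_simpl; rewrite ?andbF /=; ring.
  have Eb : y b a + y b c = 0.
    apply: only2 => // j ja jc; apply: yoff.
    by rewrite /h; neq_simpl; rewrite ?andbF /=; ring.
  have Ec : y c a + y c b = 0.
    apply: only2 => // j ja jb; apply: yoff.
    by rewrite /h; neq_simpl; rewrite ?andbF /=; ring.
  have Ea' : y a' b' + y a' c' = 0.
    apply: only2 => // j jb' jc'; have [->|ja] := eqVneq j a;
      first by rewrite yC.
    by apply: yoff; rewrite /h; neq_simpl; rewrite ?andbF /=; ring.
  have Eb' : y b' a' + y b' c' = 0.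
    apply: only2 => // j ja' jc'; apply: yoff.
    by rewrite /h; neq_simpl; rewrite ?andbF /=; ring.
  have Ec' : y c' a' + y c' b' = 0.
    apply: only2 => // j ja' jb'; apply: yoff.
    by rewrite /h; neq_simpl; rewrite ?andbF /=; ring.
  move: Eb Ec Eb' Ec'.
  rewrite (yC b a) (yC c a) (yC c b) (yC b' a') (yC c' a') (yC c' b') =>
    Eb Ec Eb' Ec'.
  (* A triangle is an odd cycle: [y a b = - y a c = y b c = - y a b], so all three values vanish. *)
  apply: (@bowtie_fun_ind R n a b c a' b' c') => [i j||||||||]; try lra.
    by rewrite yC.
  exact: yoff.
by move: fab; rewrite vab; case; lra.
Qed.

End Vertices.

(** * Shrinking blossoms by switching 4-cycles *)

Lemma mem_zip_sub (T1 T2 : eqType) (s : seq T1) (t : seq T2) x y :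
  (x, y) \in zip s t -> x \in s /\ y \in t.
Proof.
elim: s t => [|a s IH] [|b t] //=;
  rewrite !inE xpair_eqE => /orP[/andP[-> ->] //|].
by move=> /IH[-> ->]; rewrite !orbT.
Qed.

Lemma zip_swap (T1 T2 : Type) (s : seq T1) (t : seq T2) :
  [seq (p.2, p.1) | p <- zip s t] = zip t s.
Proof. by elim: s t => [|a s IH] [|b t] //=; rewrite IH. Qed.

(** Reading the sequence of pairs backwards, with the ends of each pair swapped, exchanges the two
    cycles. *)
Lemma has_blossomC n (G : sgraph n) (k l : nat) :
  has_blossom G k l -> has_blossom G l k.
Proof.
case=> v1 [v [w1 [w [sv sw U S]]]]; exists w1, (rev w), v1, (rev v).
split; [by rewrite /= size_rev | by rewrite /= size_rev | |].
  rewrite -(perm_uniq (s1 := (v1 :: v) ++ w1 :: w)) // perm_catC perm_cat //.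
    by rewrite perm_cons perm_sym perm_rev.
  by rewrite perm_cons perm_sym perm_rev.
have -> : blossom_pairs w1 (rev w) v1 (rev v)
    = [seq (p.2, p.1) | p <- rev (blossom_pairs v1 v w1 w)].
  rewrite /blossom_pairs rev_cat rev_cons cat_rcons map_cat
    /= !rev_zip ?size_rcons //.
  by rewrite !zip_swap !rev_cons !rev_rcons.
rewrite sorted_map rev_sorted; apply: sub_sorted S => p q /=.
by rewrite eq_sym !(adj_sym G _.2).
Qed.

Section Shrinking.
Variables (R : realType) (n : nat).
Implicit Types (d : n.-tuple nat) (G : sgraph n).

(** The switch of an alternating 4-cycle, obtained as a perturbation by [square_fun], which keeps
    the row sums and hence the degrees. *)
Lemma switch_realization d G (a b c e : 'I_n) : realization d G ->
  uniq [:: a; b; c;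
    e] -> G b c = ~~ G a b -> G c e = G a b -> G e a = ~~ G a b ->
  exists G', [/\ realization d G', G' a e = G a b &
    forall i j, square_fun R a b c e i j = 0 -> G' i j = G i j].
Proof.
move=> dG; rewrite /= !inE !negb_or =>
  /and4P[/and3P[ab ac ae] /andP[bc be] ce _] Gbc Gce Gea.
have gP := realization_fpoint R dG.
pose g i j : R := (G i j)%:R.
have {}gP : fpoint d g := gP; have [gC _ g01 _] := gP.
have ea : e != a by rewrite eq_sym.
pose h := square_fun R a b c e.
have hab : h a b = 1 by rewrite /h; neq_simpl; ring.
have hbc : h b c = -1 by rewrite /h; neq_simpl; ring.
have hce : h c e = 1 by rewrite /h; neq_simpl; ring.
have hea : h e a = -1 by rewrite /h; neq_simpl; ring.
have hC : forall i j, h i j = h j i by move=> i j; exact: square_funC.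
have hS : forall i, \sum_j h i j = 0 by move=> i; exact: sum_square_fun.
have gN b1 : (~~ b1)%:R = 1 - b1%:R :> R by case: b1; rewrite ?subrr ?subr0.
(* [t] is 1 if [a b] is a non-edge and -1 if it is an edge, so each pair of the cycle changes
   status. *)
pose t := 1 - 2 * g a b; pose g' i j := g i j + t * h i j.
have vab : g' a b = 1 - g a b by rewrite /g' hab /t; ring.
have vbc : g' b c = g a b by rewrite /g' hbc /t /g Gbc gN; ring.
have vce : g' c e = 1 - g a b by rewrite /g' hce /t /g Gce; ring.
have vea : g' e a = g a b by rewrite /g' hea /t /g Gea gN; ring.
have s01 : g a b = 0 \/ g a b = 1 by rewrite /g; case: (G a b); [right | left].
have g'01 : forall i j, g' i j = 0 \/ g' i j = 1.
  apply: (@square_fun_ind R n a b c e) => [i j||||| i j hij].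
  - by rewrite /g' gC hC.
  - by rewrite vab; case: s01 => ->; [right | left]; ring.
  - by rewrite vbc.
  - by rewrite vce; case: s01 => ->; [right | left]; ring.
  - by rewrite vea.
  - by rewrite /g' [h i j]hij mulr0 addr0 /g; case: (G i j); [right | left].
have g'P : fpoint d g'.
  apply: fpoint_perturb => //; first by move=> i; exact: square_fun_diag.
  by move=> i j; rewrite -/(g' i j); case: (g'01 i j) => ->;
    rewrite ?lexx ler01.
have [|G' dG' GE] := fpoint_realization g'P.
  by move=> i j; rewrite /fractional; case: (g'01 i j) => ->;
    rewrite ltxx ?andbF.
have natb (b1 b2 : bool) : b1%:R = b2%:R :> R -> b1 = b2.
  by case: b1 b2 => [] [] // /eqP; rewrite ?oner_eq0 // eq_sym oner_eq0.
exists G'; split=> //.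
  by apply: natb; rewrite -GE -[RHS]/(g a b) -vea; have [-> _ _ _] := g'P.
by move=> i j hij; apply: natb; rewrite -GE /g' [h i j]hij mulr0 addr0.
Qed.

(* The chord v1 v4 closes a 4-cycle with v1 v2 v3 v4: either it can replace the
   path v1 v2 v3 v4 at once, or this 4-cycle alternates and switching it makes
   the replacement possible. *)
Lemma blossom_shrink d G (k l : nat) : realization d G ->
  has_blossom G k.+2 l -> (2 < k)%N ->
    exists2 G', realization d G' & has_blossom G' k l.
Proof.
move=> dG [v1 [v [w1 [w [sv sw U S]]]]] k3.
case: v sv U S => [|v2 [|v3 [|v4 [|v5 v]]]] /=; try by move=> sv; exfalso; lia.
move=> [sv] U S.
(* [L] lists the pairs that follow [v4 v5], and [T] the vertices other than [v2], [v3], [v4]; all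
   pairs of [L] lie in [T]. *)
pose L := zip (v5 :: v) (rcons v v1) ++ (v1, w1) :: zip (w1 :: w) (rcons w w1).
pose T := [:: v1, v5 & v] ++ w1 :: w.
have : uniq ([:: v2; v3; v4] ++ T).
  by rewrite -(perm_uniq (s1 := [:: v1, v2, v3, v4,
    v5 & v] ++ w1 :: w)) // /T /= (perm_catCA [:: v1] [:: v2; v3; v4]).
rewrite cat_uniq => /and3P[U3 /hasPn UT UniqT].
have {}UT x : x \in T -> [/\ x != v2, x != v3 & x != v4].
  by move/UT; rewrite /= !inE !negb_or => /and3P.
have LT x y : (x, y) \in L -> x \in T /\ y \in T.
  have sub5 : {subset v5 :: v <= T} by move=> z zv;
    rewrite /T mem_cat inE zv orbT.
  have subw : {subset w1 :: w <= T} by move=> z zv; rewrite /T mem_cat zv orbT.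
  have v1T : v1 \in T by rewrite /T !inE eqxx.
  have w1T : w1 \in T by apply: subw; rewrite inE eqxx.
  rewrite mem_cat inE =>
    /or3P[/mem_zip_sub[xs]|/eqP[-> ->] //|/mem_zip_sub[xs]].
    rewrite mem_rcons inE => yv; split; first exact: sub5.
    by case/orP: yv => [/eqP -> //|yv]; apply: sub5; rewrite inE yv orbT.
  rewrite mem_rcons inE => yv; split; first exact: subw.
  by case/orP: yv => [/eqP -> //|yv]; apply: subw; rewrite inE yv orbT.
have v1T : v1 \in T by rewrite /T !inE eqxx.
have v5T : v5 \in T by rewrite /T !inE eqxx orbT.
have v15 : v5 != v1 by move: UniqT;
  rewrite /T /= !inE negb_or eq_sym => /andP[/andP[]].
have [n12 n13 n14] := UT _ v1T; have [n52 n53 n54] := UT _ v5T.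
have U4 : uniq [:: v1; v2; v3;
  v4] by rewrite cons_uniq !inE !negb_or n12 n13 n14.
have U' : uniq ([:: v1, v4, v5 & v] ++ w1 :: w).
  move: UniqT; rewrite /T /= => /andP[v1N ->];
    rewrite inE negb_or n14 v1N /= andbT.
  by apply/negP => /(fun h => UT v4 (mem_behead (s := T) h))[_ _]; rewrite eqxx.
have sz : size [:: v1, v4, v5 & v] = k by case: sv.
move: S => /= /and4P[S1 S2 S3 S4].
(* By alternation [v1 v2] and [v3 v4] have the same status; a chord that shares it can replace the
   three pairs between [v1] and [v4]. *)
have [c|c] := eqVneq (G v1 v4) (G v1 v2).
  exists G => //; exists v1, [:: v4, v5 & v], w1, w; split=> //=.
  apply/andP; split=> //; rewrite c.
  by case: (G v1 v2) (G v2 v3) (G v3 v4) (G v4 v5) S1 S2 S3 => [] [] [] [].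
(* Now the chord has the status of [v2 v3], so the 4-cycle alternates, and switching gives the chord
   the former status of [v1 v2]. *)
have [||||G' [dG' G'14 G'E]] := @switch_realization d G v1 v2 v3 v4 dG.
- exact: U4.
- by case: (G v1 v2) (G v2 v3) S1 => [] [].
- by case: (G v1 v2) (G v2 v3) (G v3 v4) S1 S2 => [] [] [].
- by rewrite adj_sym; case: (G v1 v2) (G v1 v4) c => [] [].
exists G' => //; exists v1, [:: v4, v5 & v], w1, w; split=> //=.
have keep x y : x != v2 -> x != v3 -> y != v2 -> y != v3 ->
  (x, y) != (v4, v1) ->
    (y, x) != (v4, v1) -> G' x y = G x y.
  move=> x2 x3 y2 y3 xy yx; apply: G'E.
  rewrite /square_fun !edge_fun_eq0 //; first (by ring);
    by rewrite xpair_eqE ?(negbTE x2) ?(negbTE x3) ?(negbTE y2) ?(negbTE y3) ?andbF.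
have n42 : v4 != v2 by move: U3;
  rewrite /= !inE negb_or ![_ == v4]eq_sym => /andP[/andP[]].
have n43 : v4 != v3 by move: U3;
  rewrite /= !inE negb_or ![_ == v4]eq_sym => /and3P[].
have G'45 : G' v4 v5 = G v4 v5.
  by apply: keep => //; rewrite xpair_eqE ?(negbTE v15) ?(negbTE n54) ?andbF.
apply/andP; split.
  rewrite G'14 G'45.
  by case: (G v1 v2) (G v2 v3) (G v3 v4) (G v4 v5) S1 S2 S3 => [] [] [] [].
(* The pairs from [v4 v5] on meet neither [v2] nor [v3] and differ from [v1 v4], so the switch
   leaves their status unchanged. *)
pose P p := G' p.1 p.2 == G p.1 p.2.
apply: (sub_in_path (P := P)) S4.
  by move=> p q /eqP Pp /eqP Pq; rewrite Pp Pq.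
rewrite /= {1}/P G'45 eqxx /=;
  apply/allP => -[x y] /LT[/UT[x2 x3 x4] /UT[y2 y3 y4]].
by apply/eqP/keep => //; rewrite xpair_eqE ?(negbTE x4) ?(negbTE y4).
Qed.

Lemma blossom_triangle d G (k l : nat) : odd k -> (2 < k)%N ->
  realization d G ->
  has_blossom G k l -> exists2 G', realization d G' & has_blossom G' 3 l.
Proof.
move=> ok k3; have [m ->] : exists m, k = m.*2.+3.
  by exists (k - 3)./2; rewrite -[k in LHS](odd_double_half k) ok; lia.
elim: m => [|m IH] in G *; first by exists G.
move=> dG; rewrite doubleS => /(blossom_shrink dG)[//|G' dG'].
exact: IH.
Qed.

End Shrinking.

Local Close Scope ring_scope.

Theorem theorem2 (R : realType) (n : nat) (d : n.-tuple nat) (hd : graphic d) :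
  [<-> decisive R d;
       forall k l : nat, odd k -> odd l -> 3 <= k -> 3 <= l ->
         forall G : sgraph n, realization d G -> ~ has_blossom G k l;
       forall G : sgraph n, realization d G -> ~ has_blossom G 3 3].
Proof.
tfae.
- move=> dec k l ok ol k3 l3 G dG B.
  (* The first cycle is shrunk to a triangle, the cycles are exchanged, and the other one is
     shrunk. *)
  have [G1 dG1 /has_blossomC B1] := blossom_triangle R ok k3 dG B.
  have [G2 dG2 B2] := blossom_triangle R ol l3 dG1 B1.
  exact: blossom33_not_decisive dG2 B2 dec.
- by move=> noB G; exact: noB.
- move=> noB x xV e; have xP := xV.1; have gP := coords_fpoint xP.
  have [i [j [ij ve]]] := upair_set e; rewrite -(coordsE x ve).
  apply: (not_fractional (gP)); apply/negP => f.
  have iT : i \in touched (coords x) by apply/touchedP; exists j.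
  have [G dG] := rigid_blossom hd gP (vertex_rigid xV) iT.
  exact: noB.
Qed.
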